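(* Let $\mathcal G$ be a fixed, connected, undirected graph on $N\ge 2$ nodes with Laplacian $L$ (largest eigenvalue $\lambda_N(L)$), let $0<\alpha<1/\lambda_N(L)$, $W=I_N-\alpha L$, $\mathbf A_{\mathrm{sys}}=W\otimes I_d-\mathbf P$ and $\sigma:=\|\mathbf A_{\mathrm{sys}}\|_2\in[0,1)$. Let $\mathcal U=\mathcal U_1\times\cdots\times\mathcal U_N$ with each $\mathcal U_i\subset\mathbb R^{d_i}$ nonempty, compact and convex, and let the block maps $g_i:\mathbb R^d\to\mathbb R^{d_i}$ satisfy $\|g_i(x)-g_i(y)\|_2\le L_i\|x-y\|_2$ for all $x,y\in\mathcal U$, with $L_i\ge0$; put $L_{\mathrm{blk}}:=\max_iL_i$, $g:=\sum_{i=1}^N\mathbf E_ig_i$ and $G_{\max}:=\max_{u\in\mathcal U}\|g(u)\|_2$. Fix an integer $T\ge1$ and $\eta>0$, and let $(u^k,\mathbf s^{k,t})$ be generated from some $u^0\in\mathcal U$, $\mathbf s^{0,0}\in\mathbb R^{Nd}$ by the coupled decentralized iteration of the context, with $\mathbf e^{k,t}:=\mathbf s^{k,t}-\mathbf 1_N\otimes u^k$. If $$q_T:=\sigma^T\big(1+\sqrt N\,\eta L_{\mathrm{blk}}\big)<1,$$ then for all $k\ge0$ $$\|\mathbf e^{k+1,0}\|_2\le q_T\|\mathbf e^{k,0}\|_2+\sqrt N\,\eta G_{\max}.$$ Consequently, $$\limsup_{k\to\infty}\|\mathbf e^{k,0}\|_2\le\frac{\sqrt N\,\eta G_{\max}}{1-q_T},$$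 and moreover $$\limsup_{k\to\infty}\|\mathbf e^{k,T}\|_2\le\frac{\sqrt N\,\eta G_{\max}\,\sigma^T}{1-q_T}.$$
   Context: Graphs are simple and unweighted; $L$ is the combinatorial graph Laplacian. $\|\cdot\|_2$ is the Euclidean/spectral norm, $\otimes$ the Kronecker product, $\mathbf 1_N$ the all-ones vector. Selector matrices: $d=\sum_{i=1}^N d_i$, vectors $u\in\mathbb R^d$ are partitioned into blocks $u_i\in\mathbb R^{d_i}$, and $\mathbf E_i\in\{0,1\}^{d\times d_i}$ is the block-column of $I_d$ corresponding to block $i$; $\mathbf P_i=\mathbf E_i\mathbf E_i^\top$, $\mathbf P=\mathrm{blkdiag}(\mathbf P_1,\dots,\mathbf P_N)$, so $\sum_i\mathbf P_i=I_d$. Coupled decentralized iteration: for each $k\ge0$, inner loop for $t=0,\dots,T-1$: $$\mathbf s^{k,t+1}=(W\otimes I_d)\mathbf s^{k,t}+\mathbf P\big((\mathbf 1_N\otimes u^k)-\mathbf s^{k,t}\big).$$ Write $\mathbf s^{k,T}=\mathrm{col}(s_1^{k,T},\dots,s_N^{k,T})$ with $s_i^{k,T}\in\mathbb R^d$, and $\bar s_i^{k,T}:=\mathrm{proj}_{\mathcal U}(s_i^{k,T})$ (Euclidean projection, acting blockwise). Outer update of each block: $u_i^{k+1}=\mathrm{proj}_{\mathcal U_i}\big(u_i^k-\eta\,g_i(\bar s_i^{k,T})\big)$, $i=1,\dots,N$, i.e. $u^{k+1}=\mathrm{proj}_{\mathcal U}\big(u^k-\eta\sum_i\mathbf E_ig_i(\bar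 s_i^{k,T})\big)$. Warm start: $\mathbf s^{k+1,0}:=\mathbf s^{k,T}$. *)

(* Defs.v *)
(* MathComp / MathComp-Analysis; the reals are an arbitrary R : realType. *)
From HB Require Import structures.
From mathcomp Require Import all_boot all_order all_algebra.
From mathcomp Require Import all_classical all_reals all_analysis.
From mathcomp Require Export mxtens.

Set Implicit Arguments.
Unset Strict Implicit.
Unset Printing Implicit Defensive.

Import Order.TTheory GRing.Theory Num.Theory.
Import numFieldNormedType.Exports.

Local Open Scope classical_set_scope.
Local Open Scope ring_scope.

Section EuclideanNorms.
Variable R : realType.

(* The library norm on matrices is the max-norm, hence this definition. *)
Definition enorm n (x : 'cV[R]_n) : R := Num.sqrt (\sum_(i < n) x i 0 ^+ 2).

(* Operator norm induced by enorm; the supremum is attained. *)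
Definition spectral_norm n (A : 'M[R]_n) : R :=
  sup [set enorm (A *m x) | x in [set x : 'cV[R]_n | enorm x <= 1]].

(* The set of eigenvalues is finite, so that this is a maximum whenever A has
   a real eigenvalue, in particular for a symmetric A of positive size. *)
Definition max_eigenvalue n (A : 'M[R]_n) : R := sup [set a | eigenvalue A a].

Definition is_eproj n (A : set 'cV[R]_n) (x p : 'cV[R]_n) : Prop :=
  A p /\ forall y, A y -> enorm (x - p) <= enorm (x - y).

(* The nearest point exists and is unique when A is nonempty, closed and
   convex; for other sets the value is either some nearest point or x. *)
Definition eproj n (A : set 'cV[R]_n) (x : 'cV[R]_n) : 'cV[R]_n :=
  xget x [set p | is_eproj A x p].

End EuclideanNorms.

Definition simple_graph (V : finType) (e : rel V) : Prop :=
  symmetric e /\ irreflexive e.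

Definition connected_graph (V : finType) (e : rel V) : Prop :=
  forall x y : V, connect e x y.

Section Network.
Variables (R : realType) (N : nat).

Definition laplacian (e : rel 'I_N) : 'M[R]_N :=
  \matrix_(i, j) if i == j then #|[set k | e i k]|%:R else - (e i j)%:R.

Definition mixing (e : rel 'I_N) (alpha : R) : 'M[R]_N :=
  1%:M - alpha *: laplacian e.

(* A stacked vector col(s_1, ..., s_N) with each s_i of size m is a column
   indexed by 'I_(N * m); entry p of s_i sits at mxtens_index (i, p), which is
   the indexing of the Kronecker product *t. *)
Definition stack_block m (s : 'cV[R]_(N * m)) (i : 'I_N) : 'cV[R]_m :=
  \col_p s (mxtens_index (i, p)) 0.

Definition ones_tens m (u : 'cV[R]_m) : 'cV[R]_(N * m) :=
  (const_mx 1 : 'cV[R]_N) *t u.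

(* delta_mx i i *t B i is the matrix whose only nonzero m x m block is B i, in
   diagonal position i. *)
Definition blkdiag m (B : 'I_N -> 'M[R]_m) : 'M[R]_(N * m) :=
  \sum_(i < N) delta_mx i i *t B i.

Variable d : 'I_N -> nat.

(* Vectors in R^(d_1 + ... + d_N) use the library's block indexing: block i
   of u is submxcol u i : 'cV_(d i). *)
Local Notation dtot := (\sum_(i < N) d i)%N.

Definition selector (i : 'I_N) : 'M[R]_(dtot, d i) :=
  submxrow (1%:M : 'M[R]_dtot) i.

Definition block_proj (i : 'I_N) : 'M[R]_dtot :=
  selector i *m (selector i)^T.

Definition P_sys : 'M[R]_(N * dtot) := blkdiag block_proj.

Definition A_sys (W : 'M[R]_N) : 'M[R]_(N * dtot) :=
  W *t (1%:M : 'M[R]_dtot) - P_sys.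

Definition prod_set (U : forall i : 'I_N, set 'cV[R]_(d i)) : set 'cV[R]_dtot :=
  [set u | forall i, U i (submxcol u i)].

Definition stack_map (g : forall i : 'I_N, 'cV[R]_dtot -> 'cV[R]_(d i))
    (x : 'cV[R]_dtot) : 'cV[R]_dtot :=
  \sum_(i < N) selector i *m g i x.

(* u k and s k t stand for u^k and s^{k,t}; s is constrained only for
   t <= T. *)
Definition coupled_iteration (W : 'M[R]_N)
    (U : forall i : 'I_N, set 'cV[R]_(d i))
    (g : forall i : 'I_N, 'cV[R]_dtot -> 'cV[R]_(d i))
    (eta : R) (T : nat)
    (u : nat -> 'cV[R]_dtot) (s : nat -> nat -> 'cV[R]_(N * dtot)) : Prop :=
  [/\ forall k t, (t < T)%N ->
        s k t.+1 = (W *t (1%:M : 'M[R]_dtot)) *m s k t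
                   + P_sys *m (ones_tens (u k) - s k t),
      forall k i,
        submxcol (u k.+1) i =
          eproj (U i) (submxcol (u k) i
            - eta *: g i (eproj (prod_set U) (stack_block (s k T) i)))
    & forall k, s k.+1 0%N = s k T].

Definition tracking_error (u : nat -> 'cV[R]_dtot)
    (s : nat -> nat -> 'cV[R]_(N * dtot)) (k t : nat) : 'cV[R]_(N * dtot) :=
  s k t - ones_tens (u k).

End Network.

(* Main.v *)
(* Since W 1 = 1, the tracking error obeys e^{k,t+1} = A_sys e^{k,t} in the inner
   loop, so the loop contracts it by sigma^T.  The projections are nonexpansive
   and fix u^k, hence |u^{k+1} - u^k| <= eta (G_max + L_blk |e^{k,T}|), and
   e^{k+1,0} = e^{k,T} - 1 (x) (u^{k+1} - u^k) gives the affine recurrence.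
   For sigma < 1, A_sys = I - alpha (L (x) I) - P is symmetric and its quadratic
   form lies strictly between -|x|^2 and |x|^2 for x <> 0; polarization turns
   this into |A_sys x| < |x|, and the spectral norm is attained on the unit
   ball. *)
Require Import Defs.
From mathcomp Require Import all_boot all_order all_algebra.
From mathcomp Require Import all_classical all_reals all_analysis.
From mathcomp Require Import ring lra.

Set Implicit Arguments.
Unset Strict Implicit.
Unset Printing Implicit Defensive.

Import Order.TTheory GRing.Theory Num.Theory.
Import numFieldNormedType.Exports.

Local Open Scope classical_set_scope.
Local Open Scope ring_scope.

(** * Euclidean inner product and norm on column vectors *)

Section InnerProduct.
Variable R : realType.

Definition edot n (x y : 'cV[R]_n) : R := \sum_i x i 0 * y i 0.

Lemma edotC n (x y : 'cV[R]_n) : edot x y = edot y x.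
Proof. by apply: eq_bigr => i _; rewrite mulrC. Qed.

Lemma edotDl n (x y z : 'cV[R]_n) : edot (x + y) z = edot x z + edot y z.
Proof. by rewrite -big_split; apply: eq_bigr => i _; rewrite mxE mulrDl. Qed.

Lemma edotZl n a (x y : 'cV[R]_n) : edot (a *: x) y = a * edot x y.
Proof. by rewrite /edot mulr_sumr; apply: eq_bigr => i _; rewrite mxE mulrA. Qed.

Lemma edotDr n (x y z : 'cV[R]_n) : edot z (x + y) = edot z x + edot z y.
Proof. by rewrite !(edotC z) edotDl. Qed.

Lemma edotZr n a (x y : 'cV[R]_n) : edot x (a *: y) = a * edot x y.
Proof. by rewrite !(edotC x) edotZl. Qed.

Lemma edotNl n (x y : 'cV[R]_n) : edot (- x) y = - edot x y.
Proof. by rewrite -scaleN1r edotZl mulN1r. Qed.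

Lemma edotNr n (x y : 'cV[R]_n) : edot x (- y) = - edot x y.
Proof. by rewrite !(edotC x) edotNl. Qed.

Definition edotE := (edotDl, edotDr, edotNl, edotNr, edotZl, edotZr).

Lemma edot0l n (x : 'cV[R]_n) : edot 0 x = 0.
Proof. by rewrite -(scale0r 0) edotZl mul0r. Qed.

Lemma edot_suml n (I : finType) (F : I -> 'cV[R]_n) (y : 'cV[R]_n) :
  edot (\sum_i F i) y = \sum_i edot (F i) y.
Proof.
rewrite /edot exchange_big; apply: eq_bigr => i _.
by rewrite summxE mulr_suml.
Qed.

Lemma edot_mulmxl m n (A : 'M[R]_(m, n)) x y :
  edot (A *m x) y = edot x (A^T *m y).
Proof.
rewrite /edot; under eq_bigr do rewrite mxE mulr_suml.
rewrite exchange_big; apply: eq_bigr => j _ /=.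
by rewrite mxE mulr_sumr; apply: eq_bigr => i _; rewrite !mxE; ring.
Qed.

Lemma edot_ge0 n (x : 'cV[R]_n) : 0 <= edot x x.
Proof. by apply: sumr_ge0 => i _; rewrite -expr2 sqr_ge0. Qed.

Lemma edot_eq0 n (x : 'cV[R]_n) : edot x x = 0 -> x = 0.
Proof.
move=> /eqP; rewrite psumr_eq0; last by move=> i _; rewrite -expr2 sqr_ge0.
move=> /allP x0; apply/colP => i; rewrite mxE; apply/eqP.
by have := x0 i (mem_index_enum _); rewrite /= mulf_eq0 orbb.
Qed.

Lemma edot_gt0 n (x : 'cV[R]_n) : x != 0 -> 0 < edot x x.
Proof.
by move=> x0; rewrite lt0r edot_ge0 andbT; apply: contra_neq x0 => /edot_eq0.
Qed.

Lemma enormE n (x : 'cV[R]_n) : enorm x = Num.sqrt (edot x x).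
Proof. by congr Num.sqrt; apply: eq_bigr => i _; rewrite expr2. Qed.

Lemma enorm_ge0 n (x : 'cV[R]_n) : 0 <= enorm x.
Proof. exact: sqrtr_ge0. Qed.

Lemma sqr_enorm n (x : 'cV[R]_n) : enorm x ^+ 2 = edot x x.
Proof. by rewrite enormE sqr_sqrtr // edot_ge0. Qed.

Lemma enorm_le_sqr n (x : 'cV[R]_n) c :
  0 <= c -> (enorm x <= c) = (edot x x <= c ^+ 2).
Proof. by move=> c0; rewrite -sqr_enorm ler_sqr ?nnegrE ?enorm_ge0. Qed.

Lemma enorm0 n : enorm (0 : 'cV[R]_n) = 0.
Proof. by rewrite enormE edot0l sqrtr0. Qed.

Lemma enormN n (x : 'cV[R]_n) : enorm (- x) = enorm x.
Proof. by rewrite !enormE edotNl edotNr opprK. Qed.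

Lemma enormZ n a (x : 'cV[R]_n) : enorm (a *: x) = `|a| * enorm x.
Proof.
by rewrite !enormE edotZl edotZr mulrA -expr2 sqrtrM ?sqr_ge0 // sqrtr_sqr.
Qed.

Lemma enorm_gt0 n (x : 'cV[R]_n) : x != 0 -> 0 < enorm x.
Proof. by move=> x0; rewrite enormE sqrtr_gt0 edot_gt0. Qed.

(** Expanding the square of the vector [enorm y *: x - enorm x *: y] gives
    [2 |x| |y| (|x| |y| - <x, y>) >= 0], and the positive factor cancels. *)
Lemma Cauchy_Schwarz n (x y : 'cV[R]_n) : edot x y <= enorm x * enorm y.
Proof.
have [->|x0] := eqVneq x 0; first by rewrite edot0l enorm0 mul0r.
have [->|y0] := eqVneq y 0; first by rewrite edotC edot0l enorm0 mulr0.
have := edot_ge0 (enorm y *: x - enorm x *: y).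
rewrite !edotE (edotC y x) -!sqr_enorm => h.
have xy : 0 < enorm x * enorm y by rewrite mulr_gt0 ?enorm_gt0.
rewrite -(ler_pM2l xy); nra.
Qed.

Lemma enormD n (x y : 'cV[R]_n) : enorm (x + y) <= enorm x + enorm y.
Proof.
rewrite enorm_le_sqr ?addr_ge0 ?enorm_ge0 // !edotE (edotC y x) -!sqr_enorm.
have := Cauchy_Schwarz x y; nra.
Qed.

Lemma coord_le_enorm n (x : 'cV[R]_n) i : `|x i 0| <= enorm x.
Proof.
rewrite -sqrtr_sqr ler_wsqrtr // (bigD1 i) //= lerDl.
by apply: sumr_ge0 => j _; rewrite sqr_ge0.
Qed.

End InnerProduct.

(** * Continuity of the Euclidean norm and compactness of balls and spheres *)

Section Compactness.
Variable R : realType.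

Lemma trmx_continuous m n : continuous (@trmx R m n).
Proof.
move=> /= M s /= /(nbhs_ballP (M^T)) [e e0 es].
apply/nbhs_ballP; exists e => //= A [_ MA]; apply: es; split=> // i j.
by rewrite !mxE; exact: MA.
Qed.

Lemma sum_continuous (T : topologicalType) (I : finType) (f : I -> T -> R) :
  (forall i, continuous (f i)) -> continuous (fun t => \sum_i f i t).
Proof.
move=> cf; elim: (index_enum I) => [|i r IH] t.
  by under eq_fun do rewrite big_nil; exact: cvg_cst.
under eq_fun do rewrite big_cons.
by apply: cvgD; [exact: cf|exact: IH].
Qed.

Lemma edot_continuous (T : topologicalType) n (f h : T -> 'cV[R]_n) :
  (forall i, continuous (fun t => f t i 0)) ->
  (forall i, continuous (fun t => h t i 0)) ->
  continuous (fun t => edot (f t) (h t)).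
Proof.
move=> cf ch; apply: sum_continuous => i t.
by apply: cvgM; [exact: cf|exact: ch].
Qed.

Lemma enorm_comp_continuous (T : topologicalType) n (f : T -> 'cV[R]_n) :
  (forall i, continuous (fun t => f t i 0)) ->
  continuous (fun t => enorm (f t)).
Proof.
move=> cf t; under eq_fun do rewrite enormE.
apply: continuous_comp; last exact: sqrt_continuous.
exact: (edot_continuous cf cf).
Qed.

Lemma mulmx_coord_continuous (T : topologicalType) m n (A : 'M[R]_(m, n))
    (f : T -> 'cV[R]_n) i :
  (forall j, continuous (fun t => f t j 0)) ->
  continuous (fun t => (A *m f t) i 0).
Proof.
move=> cf.
under eq_fun do rewrite mxE.
apply: sum_continuous => j t; apply: cvgM; first exact: cvg_cst.
exact: cf.
Qed.

Lemma subr_coord_continuous (T : topologicalType) n (x : 'cV[R]_n)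
    (f : T -> 'cV[R]_n) i :
  continuous (fun t => f t i 0) -> continuous (fun t => (x - f t) i 0).
Proof.
move=> cf t; under eq_fun do rewrite !mxE.
by apply: cvgB; [exact: cvg_cst|exact: cf].
Qed.

Lemma closed_enorm_bounded_compact n (A : set 'cV[R]_n) c :
  closed A -> (forall x, A x -> enorm x <= c) -> compact A.
Proof.
move=> clA bA.
(* [bounded_closed_compact] concerns row vectors, so [A] is written as the continuous image, under
   transposition, of a set of rows. *)
have -> : A = trmx @` ((@trmx R 1 n) @^-1` A).
  rewrite eqEsubset; split => [x Ax|_ [y Ay <-]] //.
  by exists x^T; rewrite /= trmxK.
apply: continuous_compact.
  exact/continuous_subspaceT/trmx_continuous.
apply: bounded_closed_compact; last first.
  by apply: (continuous_closedP _).1 => //; exact: trmx_continuous.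
exists `|c|; split; first exact: normr_real.
move=> M cM x /= /bA xc; rewrite [leLHS](_ : _ = mx_norm x) // mx_normrE.
have xM : enorm x^T <= M by rewrite (le_trans xc) // (le_trans (ler_norm _)) // ltW.
apply: bigmax_le => [|[i j] _]; first by rewrite (le_trans _ xM) ?enorm_ge0.
rewrite /= (ord1 i); apply: le_trans xM; apply: le_trans (coord_le_enorm _ j).
by rewrite mxE.
Qed.

Lemma enorm_continuous n : continuous (@enorm R n).
Proof. by apply: enorm_comp_continuous => i; exact: coord_continuous. Qed.

Lemma compact_eball n c : compact [set x : 'cV[R]_n | enorm x <= c].
Proof.
apply: (@closed_enorm_bounded_compact _ _ c) => //.
apply: ((continuous_closedP _).1 (@enorm_continuous n) [set y | y <= c]).
exact: closed_le.
Qed.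

Lemma compact_esphere n c : compact [set x : 'cV[R]_n | enorm x = c].
Proof.
apply: (@closed_enorm_bounded_compact _ _ c) => [|x /= ->//].
apply: ((continuous_closedP _).1 (@enorm_continuous n) [set y | y = c]).
exact: closed_eq.
Qed.

End Compactness.

(** * Quadratic forms, largest eigenvalue and spectral norm *)

Section Symmetric.
Variable R : realType.

(* At a maximum point of the quadratic form on the sphere the nonnegative form
   [c |x|^2 - x^T A x] vanishes, hence so does its gradient. *)
Lemma Rayleigh_max_eigenvector n (A : 'M[R]_n) c (x : 'cV[R]_n) :
  A^T = A -> (forall y, edot (A *m y) y <= c * edot y y) ->
  edot (A *m x) x = c * edot x x -> A *m x = c *: x.
Proof.
move=> symA hA hx; apply/eqP; rewrite -subr_eq0; apply/eqP.
have [y yE] : exists y, y = A *m x - c *: x by exists (A *m x - c *: x).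
rewrite -yE.
have AC z w : edot (A *m z) w = edot (A *m w) z.
  by rewrite edot_mulmxl symA edotC.
have key t : 2 * t * edot y y <= t ^+ 2 * (c * edot y y - edot (A *m y) y).
  have := hA (x + t *: y).
  rewrite mulmxDr -scalemxAr !edotE hx (AC y x) (edotC y x) => h.
  have e : edot y y = edot (A *m x) y - c * edot x y.
    by rewrite {1}yE edotDl edotNl edotZl.
  nra.
apply: edot_eq0; apply/eqP; rewrite eq_le edot_ge0 andbT leNgt; apply/negP => y0.
set b := c * edot y y - edot (A *m y) y in key.
have b0 : 0 <= b by rewrite subr_ge0 hA.
(* For small [t] the linear side of [key] beats the quadratic one. The [+ 1] keeps the denominator
   positive when [b = 0]. *)
have := key (edot y y / (b + 1)).
have b1 : 0 < b + 1 by rewrite ltr_pwDr.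
have t0 : 0 < edot y y / (b + 1) by rewrite divr_gt0.
set t := edot y y / (b + 1) in t0 *.
have tE : edot y y = t * (b + 1) by rewrite /t divfK ?gt_eqF.
rewrite tE; nra.
Qed.

(** By compactness the form attains a maximum [c] on the unit sphere, and homogeneity extends the
    bound to all vectors. The maximizer is then an eigenvector for [c], so [c] is below the supremum
    of the eigenvalues. *)
Lemma le_max_eigenvalue n (A : 'M[R]_n) (x : 'cV[R]_n) :
  A^T = A -> edot (A *m x) x <= max_eigenvalue A * edot x x.
Proof.
move=> symA.
have [->|x0] := eqVneq x 0; first by rewrite mulmx0 edot0l mulr0.
have nZ (y : 'cV[R]_n) : y != 0 -> enorm ((enorm y)^-1 *: y) = 1.
  move=> y0; rewrite enormZ ger0_norm ?invr_ge0 ?enorm_ge0 // mulVf //.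
  by rewrite gt_eqF ?enorm_gt0.
have [|||v /set_mem /= v1 vmax] := @compact_EVT_max _ R
    (fun y : 'cV[R]_n => edot (A *m y) y) [set y : 'cV[R]_n | enorm y = 1].
- by exists ((enorm x)^-1 *: x); exact: nZ.
- exact: compact_esphere.
- apply: continuous_subspaceT; apply: edot_continuous => i.
    by apply: mulmx_coord_continuous => j; exact: coord_continuous.
  exact: coord_continuous.
set c := edot (A *m v) v in vmax.
have hA y : edot (A *m y) y <= c * edot y y.
  have [->|y0] := eqVneq y 0; first by rewrite mulmx0 !edot0l mulr0.
  have /vmax : (enorm y)^-1 *: y \in [set y : 'cV[R]_n | enorm y = 1].
    by apply/mem_set; exact: nZ.
  rewrite -scalemxAr edotZl edotZr mulrA -expr2 exprVn sqr_enorm.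
  by rewrite ler_pdivrMl ?edot_gt0 // mulrC.
have v11 : edot v v = 1 by rewrite -sqr_enorm v1 expr1n.
have ev : A *m v = c *: v.
  by apply: Rayleigh_max_eigenvector => //; rewrite v11 mulr1.
apply: le_trans (hA x) _; rewrite ler_wpM2r ?edot_ge0 //.
apply: ub_le_sup.
  (* The supremum needs a bounded set: [c] itself dominates every eigenvalue. Eigenvectors are rows
     here, hence the transpositions. *)
  exists c => a /= /eigenvalueP [w wA w0].
  have wA' : A *m w^T = a *: w^T by rewrite -symA -trmx_mul wA linearZ.
  have w0' : w^T != 0 by rewrite trmx_eq0.
  by have := hA w^T; rewrite wA' edotZl ler_pM2r ?edot_gt0.
apply/eigenvalueP; exists v^T; last first.
  rewrite trmx_eq0; apply/eqP => v0; move: v11; rewrite v0 edot0l.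
  by move/eqP; rewrite eq_sym oner_eq0.
by rewrite -[in LHS]symA -trmx_mul ev linearZ.
Qed.

(* Polarization: 4 <A x, y> = q (x + y) - q (x - y) with y := A x. *)
Lemma enorm_mulmx_lt n (A : 'M[R]_n) (x : 'cV[R]_n) :
  A^T = A -> (forall y, y != 0 -> `|edot (A *m y) y| < edot y y) ->
  x != 0 -> enorm (A *m x) < enorm x.
Proof.
move=> symA hA x0; set y := A *m x.
have hA' z : `|edot (A *m z) z| <= edot z z.
  have [->|z0] := eqVneq z 0; first by rewrite mulmx0 edot0l normr0.
  by rewrite ltW ?hA.
have AC z w : edot (A *m z) w = edot (A *m w) z.
  by rewrite edot_mulmxl symA edotC.
have lt4 : 4 * edot y y < edot (x + y) (x + y) + edot (x - y) (x - y).
  have -> : 4 * edot y y =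
      edot (A *m (x + y)) (x + y) - edot (A *m (x - y)) (x - y).
    by rewrite !mulmxDr !mulmxN !edotE (AC y x) -/y; ring.
  (* Strictness is required at only one of [x + y] and [x - y]. They cannot both vanish, since their
     sum is [2 *: x]. *)
  have [xy0|xy0] := eqVneq (x + y) 0; last first.
    have := hA _ xy0; have := hA' (x - y).
    by rewrite ler_norml ltr_norml => /andP[h1 h2] /andP[h3 h4]; lra.
  have xy1 : x - y != 0.
    apply: contra_neq x0 => xy1.
    have : 2 *: x = (x + y) + (x - y) by rewrite scaler_nat mulr2n addrACA subrr addr0.
    rewrite xy0 xy1 addr0 => /eqP.
    by rewrite scaler_eq0 pnatr_eq0 /= => /eqP.
  have := hA _ xy1; have := hA' (x + y).
  by rewrite ler_norml ltr_norml => /andP[h1 h2] /andP[h3 h4]; lra.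
(* By the parallelogram identity the right side of [lt4] is [2 |x|^2 + 2 |y|^2]. *)
rewrite -ltr_sqr ?nnegrE ?enorm_ge0 // !sqr_enorm.
move: lt4; rewrite !edotE (edotC y x); lra.
Qed.

Lemma spectral_norm_bounded n (A : 'M[R]_n) :
  exists2 v : 'cV[R]_n, enorm v <= 1 & spectral_norm A = enorm (A *m v) /\
   forall x, enorm x <= 1 -> enorm (A *m x) <= enorm (A *m v).
Proof.
have [|||v /set_mem /= v1 vmax] := @compact_EVT_max _ R
    (fun y : 'cV[R]_n => enorm (A *m y)) [set y : 'cV[R]_n | enorm y <= 1].
- by exists 0; rewrite /= enorm0.
- exact: compact_eball.
- apply: continuous_subspaceT; apply: enorm_comp_continuous => i.
  by apply: mulmx_coord_continuous => j; exact: coord_continuous.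
have vm x : enorm x <= 1 -> enorm (A *m x) <= enorm (A *m v).
  by move=> x1; apply: vmax; apply/mem_set.
exists v => //; split => //; apply/eqP; rewrite eq_le; apply/andP; split.
  apply: ge_sup; first by exists (enorm (A *m v)), v.
  by move=> _ [x x1 <-]; exact: vm.
apply: ub_le_sup; last by exists v.
by exists (enorm (A *m v)) => _ [x x1 <-]; exact: vm.
Qed.

Lemma spectral_norm_ge0 n (A : 'M[R]_n) : 0 <= spectral_norm A.
Proof. by have [v _ [-> _]] := spectral_norm_bounded A; exact: enorm_ge0. Qed.

Lemma enorm_mulmx_le n (A : 'M[R]_n) (x : 'cV[R]_n) :
  enorm (A *m x) <= spectral_norm A * enorm x.
Proof.
have [v _ [-> vm]] := spectral_norm_bounded A.
have [->|x0] := eqVneq x 0; first by rewrite mulmx0 enorm0 mulr0.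
have := vm ((enorm x)^-1 *: x).
have x1 := enorm_gt0 x0.
rewrite -scalemxAr !enormZ ger0_norm ?invr_ge0 ?enorm_ge0 //.
by rewrite mulVf ?gt_eqF // => /(_ (lexx _)); rewrite ler_pdivrMl // mulrC.
Qed.

(** Pointwise strictness survives the supremum because the supremum is attained, at some [v] of the
    unit ball. *)
Lemma spectral_norm_lt1 n (A : 'M[R]_n) :
  A^T = A -> (forall y, y != 0 -> `|edot (A *m y) y| < edot y y) ->
  spectral_norm A < 1.
Proof.
move=> symA hA; have [v v1 [-> _]] := spectral_norm_bounded A.
have [->|v0] := eqVneq v 0; first by rewrite mulmx0 enorm0.
exact: lt_le_trans (enorm_mulmx_lt symA hA v0) v1.
Qed.

End Symmetric.

(** * Stacked vectors, Kronecker products and block-diagonal matrices *)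

Section Stacking.
Variables (R : realType) (N m : nat).
Implicit Types x y : 'cV[R]_(N * m).

Lemma sum_mxtens (F : 'I_(N * m) -> R) :
  \sum_k F k = \sum_i \sum_p F (mxtens_index (i, p)).
Proof.
rewrite pair_big (reindex (@mxtens_index N m)) /=.
  by apply: eq_bigr => -[i p].
by exists (@mxtens_unindex N m) => ? _; rewrite ?mxtens_indexK ?mxtens_unindexK.
Qed.

Lemma edot_stack x y :
  edot x y = \sum_i edot (stack_block x i) (stack_block y i).
Proof.
by rewrite {1}/edot sum_mxtens; apply: eq_bigr => i _; apply: eq_bigr => p _;
  rewrite !mxE.
Qed.

Lemma stack_block_inj x y :
  (forall i, stack_block x i = stack_block y i) -> x = y.
Proof.
move=> xy; apply/colP => k; case: (mxtens_indexP k) => i p.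
by have /colP/(_ p) := xy i; rewrite !mxE.
Qed.

Lemma stack_blockD x y i :
  stack_block (x + y) i = stack_block x i + stack_block y i.
Proof. by apply/colP => p; rewrite !mxE. Qed.

Lemma stack_blockN x i : stack_block (- x) i = - stack_block x i.
Proof. by apply/colP => p; rewrite !mxE. Qed.

Lemma stack_blockZ a x i : stack_block (a *: x) i = a *: stack_block x i.
Proof. by apply/colP => p; rewrite !mxE. Qed.

Lemma stack_block0 i : stack_block (0 : 'cV[R]_(N * m)) i = 0.
Proof. by apply/colP => p; rewrite !mxE. Qed.

Lemma stack_block_ones (u : 'cV[R]_m) i : stack_block (ones_tens N u) i = u.
Proof.
by apply/colP => p; rewrite !mxE mxtens_indexK mul1r (ord1 (mxtens_unindex _).2).
Qed.

Definition stack_blockE :=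
  (stack_blockD, stack_blockN, stack_blockZ, stack_block_ones).

Lemma stack_block_tens1 (A : 'M[R]_N) x i :
  stack_block ((A *t 1%:M) *m x) i = \sum_j A i j *: stack_block x j.
Proof.
apply/colP => p; rewrite !mxE sum_mxtens summxE; apply: eq_bigr => j _.
rewrite (bigD1 p) //= big1 => [|q qp]; rewrite tensmxE !mxE.
  by rewrite eqxx mulr1 addr0.
by rewrite eq_sym (negPf qp) mulr0 mul0r.
Qed.

Lemma stack_block_blkdiag (B : 'I_N -> 'M[R]_m) x i :
  stack_block (blkdiag B *m x) i = B i *m stack_block x i.
Proof.
apply/colP => p; rewrite !mxE sum_mxtens (bigD1 i) //= [X in _ + X]big1 => [|j ji].
  rewrite addr0; apply: eq_bigr => q _; rewrite mxE; congr (_ * _).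
  rewrite summxE (bigD1 i) //= big1 ?addr0 => [|k ki].
    by rewrite tensmxE mxE !eqxx mul1r.
  by rewrite tensmxE mxE eq_sym (negPf ki) mul0r.
rewrite big1 // => q _; rewrite summxE big1 ?mul0r // => k _.
rewrite tensmxE mxE; case: eqVneq => [<-|_]; last by rewrite mul0r.
by rewrite (negPf ji) mul0r.
Qed.

Lemma enorm_ones (u : 'cV[R]_m) :
  enorm (ones_tens N u) = Num.sqrt N%:R * enorm u.
Proof.
rewrite !enormE edot_stack; under eq_bigr do rewrite stack_block_ones.
by rewrite sumr_const card_ord -sqrtrM ?ler0n // mulr_natl.
Qed.

Lemma ones_tensB (u v : 'cV[R]_m) :
  ones_tens N (u - v) = ones_tens N u - ones_tens N v.
Proof. by apply: stack_block_inj => i; rewrite !stack_blockE. Qed.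

(** Regrouping by the inner index [p] splits [x] into slices [y p] in R^N, on each of which the
    tensor product acts as [A]. This carries the eigenvalue bound from the Laplacian to its
    Kronecker product with the identity. *)
Lemma edot_tens1_le (A : 'M[R]_N) c x :
  (forall y : 'cV[R]_N, edot (A *m y) y <= c * edot y y) ->
  edot ((A *t 1%:M) *m x) x <= c * edot x x.
Proof.
move=> Ac; pose y p := \col_i x (mxtens_index (i, p)) 0.
have -> : edot x x = \sum_p edot (y p) (y p).
  rewrite /edot sum_mxtens exchange_big; apply: eq_bigr => p _.
  by apply: eq_bigr => i _; rewrite !mxE.
have -> : edot ((A *t 1%:M) *m x) x = \sum_p edot (A *m y p) (y p).
  rewrite edot_stack /edot exchange_big; apply: eq_bigr => p _.
  apply: eq_bigr => i _; rewrite stack_block_tens1 !mxE summxE.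
  by congr (_ * _); apply: eq_bigr => j _; rewrite !mxE.
by rewrite mulr_sumr; apply: ler_sum => p _.
Qed.

End Stacking.

(** * Block decomposition of R^d, selectors and the matrix P *)

Section BlockVectors.
Variables (R : realType) (N : nat) (d : 'I_N -> nat).
Local Notation dtot := (\sum_(i < N) d i)%N.
Implicit Types u v : 'cV[R]_dtot.

Lemma edot_submxcol u v :
  edot u v = \sum_i edot (submxcol u i) (submxcol v i).
Proof.
pose F i (k : 'I_(d i)) := u (tagnat.Rank i k) 0 * v (tagnat.Rank i k) 0.
transitivity (\sum_i \sum_k F i k).
  rewrite sig_big_dep /edot (reindex tagnat.rank) /=; last exact: tagnat.rank_bij_on.
  by apply: eq_bigr => -[i k] _.
by apply: eq_bigr => i _; apply: eq_bigr => k _; rewrite !mxE.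
Qed.

Lemma submxcol_inj u v : (forall i, submxcol u i = submxcol v i) -> u = v.
Proof. by move=> uv; rewrite -(submxcolK u) -(submxcolK v); apply: eq_mxcol. Qed.

Lemma submxcolZ a u i : submxcol (a *: u) i = a *: submxcol u i.
Proof. by apply/colP => p; rewrite !mxE. Qed.

Lemma mul_tr_selector i u : (selector R d i)^T *m u = submxcol u i.
Proof. by rewrite tr_submxrow trmx1 submxcol_mul mul1mx. Qed.

Lemma edot_block_proj i u :
  edot (block_proj R d i *m u) u = edot (submxcol u i) (submxcol u i).
Proof. by rewrite -mulmxA edot_mulmxl !mul_tr_selector. Qed.

Lemma submxcol_stack_map (g : forall i, 'cV[R]_dtot -> 'cV[R]_(d i)) u i :
  submxcol (stack_map g u) i = g i u.
Proof.
rewrite submxcol_sum (bigD1 i) //= [X in _ + X]big1 => [|j ji].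
  rewrite addr0 -submxcol_mul [submxcol _ i](_ : _ = 1%:M) ?mul1mx //.
  apply/matrixP => k l; rewrite !mxE -val_eqE /= tagnat.eq_Rank eqxx /=.
  by [].
rewrite -submxcol_mul [submxcol _ i](_ : _ = 0) ?mul0mx //.
apply/matrixP => k l; rewrite !mxE -val_eqE /= tagnat.eq_Rank.
by rewrite eq_sym (negPf ji).
Qed.

Lemma edot_P_sys (x : 'cV[R]_(N * dtot)) :
  edot (P_sys R d *m x) x =
  \sum_i edot (submxcol (stack_block x i) i) (submxcol (stack_block x i) i).
Proof.
rewrite edot_stack; apply: eq_bigr => i _.
by rewrite stack_block_blkdiag edot_block_proj.
Qed.

(** Copy [i] contributes only its own [i]-th block, one of the nonnegative terms that make up its
    squared norm. *)
Lemma edot_P_sys_le (x : 'cV[R]_(N * dtot)) :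
  edot (P_sys R d *m x) x <= edot x x.
Proof.
rewrite edot_P_sys (edot_stack x); apply: ler_sum => i _.
rewrite (edot_submxcol (stack_block x i)) [leRHS](bigD1 i) //= lerDl.
by apply: sumr_ge0 => j _; exact: edot_ge0.
Qed.

Lemma trmx_P_sys : (P_sys R d)^T = P_sys R d.
Proof.
rewrite /P_sys /blkdiag linear_sum; apply: eq_bigr => i _ /=.
by rewrite trmx_tens trmx_delta trmx_mul trmxK.
Qed.

End BlockVectors.

(** * The graph Laplacian form and the symmetric matrix [A_sys] *)

Section Laplacian.
Variables (R : realType) (N : nat) (e : rel 'I_N).
Hypothesis he : simple_graph e.

(** Irreflexivity makes the subtracted [e i i] zero, so one formula serves on and off the
    diagonal. *)
Lemma laplacianE i j :
  laplacian R e i j = (i == j)%:R * (\sum_k (e i k)%:R) - (e i j)%:R.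
Proof.
have [_ irr] := he; rewrite mxE; case: eqVneq => [->|_]; last by rewrite mul0r sub0r.
rewrite irr mul1r subr0 -natr_sum; congr (_%:R).
rewrite -sum1_card big_mkcond; apply: eq_bigr => k _.
by rewrite -topredE /= /in_set asboolb; case: (e j k).
Qed.

Lemma trmx_laplacian : (laplacian R e)^T = laplacian R e.
Proof.
have [sym _] := he; apply/matrixP => i j; rewrite !mxE eq_sym sym.
by case: eqVneq => // ->.
Qed.

(** The general module [V] allows the [x j] to be the vector blocks of a stacked vector. *)
Lemma sum_laplacian (V : lmodType R) i (x : 'I_N -> V) :
  \sum_j laplacian R e i j *: x j = \sum_j (e i j)%:R *: (x i - x j).
Proof.
under [RHS]eq_bigr do rewrite scalerBr.
under [LHS]eq_bigr do rewrite laplacianE scalerBl.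
rewrite !sumrB; congr (_ - _); rewrite [LHS](bigD1 i) //= [X in _ + X]big1 => [|j ji].
  by rewrite eqxx mul1r addr0 scaler_suml.
by rewrite eq_sym (negPf ji) mul0r scale0r.
Qed.

(** Exchanging [i] and [j] flips the sign of the difference [D i j]. Adding the two resulting
    expressions [q1] and [q2] for the form completes the squares; each edge is counted in both
    orientations, hence the factor 2. *)
Lemma edot_laplacian m (x : 'cV[R]_(N * m)) :
  2 * edot ((laplacian R e *t 1%:M) *m x) x =
  \sum_i \sum_j (e i j)%:R *
    edot (stack_block x i - stack_block x j) (stack_block x i - stack_block x j).
Proof.
have [sym _] := he.
rewrite edot_stack; set q := \sum_i edot _ _.
pose D i j := stack_block x i - stack_block x j.
have q1 : q = \sum_i \sum_j (e i j)%:R * edot (D i j) (stack_block x i).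
  apply: eq_bigr => i _; rewrite stack_block_tens1 sum_laplacian edot_suml.
  by apply: eq_bigr => j _; rewrite edotZl.
have q2 : q = - \sum_i \sum_j (e i j)%:R * edot (D i j) (stack_block x j).
  rewrite q1 exchange_big -sumrN; apply: eq_bigr => i _.
  rewrite -sumrN; apply: eq_bigr => j _.
  by rewrite sym /D -opprB edotNl mulrN.
rewrite mulr_natl mulr2n {1}q1 q2 -sumrB; apply: eq_bigr => i _.
rewrite -sumrB; apply: eq_bigr => j _.
by rewrite /D [in RHS]edotDr edotNr mulrDr mulrN.
Qed.

Lemma edot_laplacian_ge0 m (x : 'cV[R]_(N * m)) :
  0 <= edot ((laplacian R e *t 1%:M) *m x) x.
Proof.
rewrite -(pmulr_rge0 _ (ltr0Sn R 1)) edot_laplacian.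
by do 2!apply: sumr_ge0 => ? _; rewrite mulr_ge0 ?ler0n ?edot_ge0.
Qed.

(** A vanishing sum of nonnegative terms makes the blocks agree across every edge, and agreement
    propagates along paths. *)
Lemma edot_laplacian_eq0 m (x : 'cV[R]_(N * m)) : connected_graph e ->
  edot ((laplacian R e *t 1%:M) *m x) x = 0 ->
  forall i j, stack_block x i = stack_block x j.
Proof.
move=> con /(congr1 ( *%R 2)); rewrite edot_laplacian mulr0 => /eqP.
have pos i j : 0 <= (e i j)%:R *
    edot (stack_block x i - stack_block x j) (stack_block x i - stack_block x j).
  by rewrite mulr_ge0 ?ler0n ?edot_ge0.
rewrite psumr_eq0 => [/allP q0|i _]; last exact: sumr_ge0.
have step i j : e i j -> stack_block x i = stack_block x j.
  move=> eij; have /= := q0 i (mem_index_enum _).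
  rewrite psumr_eq0 // => /allP/(_ j (mem_index_enum _)) /=.
  by rewrite eij mul1r => /eqP/edot_eq0/eqP; rewrite subr_eq0 => /eqP.
move=> i j; have /connectP[p ip ->] := con i j.
elim: p i ip => //= k p IH i /andP[/step -> kp]; exact: IH.
Qed.

Lemma mixing_tens1 alpha m (x : 'cV[R]_(N * m)) :
  (mixing e alpha *t 1%:M) *m x = x - alpha *: ((laplacian R e *t 1%:M) *m x).
Proof.
apply: stack_block_inj => i; rewrite !stack_blockE !stack_block_tens1.
have WE j : mixing e alpha i j = (i == j)%:R - alpha * laplacian R e i j.
  by rewrite [LHS]mxE; congr (_ + _); rewrite mxE // mxE.
under eq_bigr do rewrite WE scalerBl -scalerA.
rewrite sumrB -scaler_sumr; congr (_ - _).
rewrite [LHS](bigD1 i) //= big1 => [|j ji]; first by rewrite eqxx scale1r addr0.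
by rewrite eq_sym (negPf ji) scale0r.
Qed.

Lemma mixing_ones alpha m (u : 'cV[R]_m) :
  (mixing e alpha *t 1%:M) *m ones_tens N u = ones_tens N u.
Proof.
rewrite mixing_tens1; apply: stack_block_inj => i.
rewrite !stack_blockE stack_block_tens1 sum_laplacian big1 ?scaler0 ?subr0 // => j _.
by rewrite !stack_block_ones subrr scaler0.
Qed.

Variables (d : 'I_N -> nat) (alpha : R).

Lemma mul_A_sys (x : 'cV[R]_(N * \sum_(i < N) d i)) :
  A_sys d (mixing e alpha) *m x =
  (mixing e alpha *t 1%:M) *m x - P_sys R d *m x.
Proof. exact: mulmxBl. Qed.

Lemma trmx_A_sys :
  (A_sys d (mixing e alpha))^T = A_sys d (mixing e alpha).
Proof.
rewrite linearB /= trmx_P_sys trmx_tens trmx1; congr (_ *t _ - _).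
by rewrite linearB linearZ /= trmx1 trmx_laplacian.
Qed.

(* [x^T A_sys x = |x|^2 - alpha x^T (L (x) I) x - x^T P x]: equality with [|x|^2]
   forces [x] to be a consensus vector whose every block [i] has a vanishing
   [i]-th part, and the value stays above [-|x|^2] because [alpha L < I], [P <= I]. *)
Lemma A_sys_form_lt (x : 'cV[R]_(N * \sum_(i < N) d i)) :
  connected_graph e -> 0 < alpha -> alpha < 1 / max_eigenvalue (laplacian R e) ->
  x != 0 -> `|edot (A_sys d (mixing e alpha) *m x) x| < edot x x.
Proof.
move=> con a0 a1 x0.
(* Positivity is read off from [0 < alpha < 1 / lambda]; it allows the upper bound on [alpha] to be
   multiplied out. *)
have lam0 : 0 < max_eigenvalue (laplacian R e).
  by rewrite -invr_gt0 -div1r (lt_trans a0).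
have xx := edot_gt0 x0.
have L0 := edot_laplacian_ge0 x.
have L1 : alpha * edot ((laplacian R e *t 1%:M) *m x) x < edot x x.
  have h : edot ((laplacian R e *t 1%:M) *m x) x <=
      max_eigenvalue (laplacian R e) * edot x x.
    by apply: edot_tens1_le => y; apply: le_max_eigenvalue; exact: trmx_laplacian.
  rewrite (le_lt_trans (ler_wpM2l (ltW a0) h)) // mulrA gtr_pMl //.
  by rewrite -ltr_pdivlMr.
have P0 : 0 <= edot (P_sys R d *m x) x.
  by rewrite edot_P_sys; apply: sumr_ge0 => i _; exact: edot_ge0.
have P1 := edot_P_sys_le x.
rewrite mul_A_sys mixing_tens1 !edotE.
set l := edot (_ *t _ *m x) x in L0 L1 *; set p := edot (P_sys R d *m x) x in P0 P1 *.
rewrite ltr_norml; apply/andP; split; first by lra.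
have {}L0 : 0 <= alpha * l by rewrite mulr_ge0 // ltW.
rewrite ltNge; apply/negP => h.
have al0 : alpha * l = 0 by apply/eqP; rewrite eq_le; apply/andP; split; lra.
have l0 : l = 0 by move/eqP: al0; rewrite mulf_eq0 (gt_eqF a0) => /eqP.
have p0 : p = 0 by apply/eqP; rewrite eq_le; apply/andP; split; lra.
move/eqP: x0; apply.
have eqx := edot_laplacian_eq0 con l0.
have sub0 i : submxcol (stack_block x i) i = 0.
  apply: edot_eq0; move/eqP: p0; rewrite /p edot_P_sys psumr_eq0 => [/allP h0|k _].
    exact/eqP/(h0 i (mem_index_enum _)).
  exact: edot_ge0.
(* By consensus, block [j] of copy [i] equals block [j] of copy [j], which is zero. *)
apply: stack_block_inj => i; apply: submxcol_inj => j.
by rewrite stack_block0 submxcol0 (eqx i j) sub0.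
Qed.

End Laplacian.

(** * Euclidean projection onto convex sets and onto products *)

Section Projection.
Variable R : realType.

Lemma convex_comb n (A : set 'cV[R]_n) x y t :
  @convex_set R 'cV[R]_n A -> A x -> A y -> 0 <= t -> t <= 1 ->
  A (t *: x + (1 - t) *: y).
Proof.
move=> cA Ax Ay t0 t1; apply: set_mem.
exact: (cA x y (Itv01 t0 t1) (mem_set Ax) (mem_set Ay)).
Qed.

Lemma ler_enorm m n (x : 'cV[R]_m) (y : 'cV[R]_n) :
  (enorm x <= enorm y) = (edot x x <= edot y y).
Proof. by rewrite enorm_le_sqr ?enorm_ge0 // sqr_enorm. Qed.

Lemma enorm_eq0 n (x : 'cV[R]_n) : enorm x = 0 -> x = 0.
Proof. by move=> x0; apply: edot_eq0; rewrite -sqr_enorm x0 expr0n. Qed.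

Lemma is_eproj_exists n (A : set 'cV[R]_n) x :
  A !=set0 -> compact A -> exists p, is_eproj A x p.
Proof.
move=> A0 cA.
have [|p /set_mem Ap pmin] := @compact_EVT_min _ R (fun y : 'cV[R]_n => enorm (x - y)) A A0 cA.
  apply: continuous_subspaceT; apply: enorm_comp_continuous => i.
  by apply: subr_coord_continuous; exact: coord_continuous.
by exists p; split => // y Ay; apply: pmin; exact: mem_set.
Qed.

Lemma eproj_is_eproj n (A : set 'cV[R]_n) x :
  (exists p, is_eproj A x p) -> is_eproj A x (eproj A x).
Proof. by move=> exA; exact: (xgetPex x exA). Qed.

Lemma is_eproj_id n (A : set 'cV[R]_n) x p : A x -> is_eproj A x p -> p = x.
Proof.
move=> Ax [_ /(_ x Ax)]; rewrite subrr enorm0 => h.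
apply/esym/eqP; rewrite -subr_eq0; apply/eqP; apply: enorm_eq0.
by apply/eqP; rewrite eq_le h enorm_ge0.
Qed.

(** If the inner product [a] were positive, a step of length [t] from [p] towards [y] would change
    the squared distance to [x] by [- 2 t a + t^2 b < 0], against minimality of [p]. *)
Lemma is_eproj_obtuse n (A : set 'cV[R]_n) x p y :
  @convex_set R 'cV[R]_n A -> is_eproj A x p -> A y -> edot (x - p) (y - p) <= 0.
Proof.
move=> cA [Ap pmin] Ay; rewrite leNgt; apply/negP.
set a := edot _ _ => a0; pose b := edot (y - p) (y - p).
have b0 : 0 <= b by exact: edot_ge0.
have ab : 0 < a + b by rewrite ltr_pwDl.
(* With [a + b] in place of the minimizing denominator [b], the step stays in [[0, 1]] and [b = 0]
   needs no separate case. *)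
pose t := a / (a + b).
have t0 : 0 < t by rewrite divr_gt0.
have t1 : t <= 1 by rewrite ler_pdivrMr // mul1r lerDl.
have tE : t * (a + b) = a by rewrite /t divfK // gt_eqF.
have := pmin _ (convex_comb cA Ay Ap (ltW t0) t1).
have -> : x - (t *: y + (1 - t) *: p) = (x - p) - t *: (y - p).
  by apply/colP => i; rewrite !mxE; ring.
have sqrE (v w : 'cV[R]_n) : edot (v - t *: w) (v - t *: w) =
    edot v v - 2 * t * edot v w + t ^+ 2 * edot w w.
  by rewrite !edotE (edotC w v); ring.
rewrite ler_enorm sqrE -/a -/b; nra.
Qed.

(** The obtuse-angle inequalities at [p] and at [q] add up to [|p - q|^2 <= <x - y, p - q>];
    Cauchy-Schwarz then allows division by [|p - q|]. *)
Lemma is_eproj_nonexpansive n (A : set 'cV[R]_n) x y p q :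
  @convex_set R 'cV[R]_n A -> is_eproj A x p -> is_eproj A y q ->
  enorm (p - q) <= enorm (x - y).
Proof.
move=> cA Pp Pq.
have h1 := is_eproj_obtuse cA Pp Pq.1.
have h2 := is_eproj_obtuse cA Pq Pp.1.
have h : enorm (p - q) ^+ 2 <= edot (x - y) (p - q).
  rewrite sqr_enorm; move: h1 h2; rewrite !edotE (edotC q p); lra.
have := le_trans h (Cauchy_Schwarz _ _).
have := enorm_ge0 (p - q); rewrite le_eqVlt => /orP[/eqP <- _|pq0].
  exact: enorm_ge0.
by rewrite expr2 ler_pM2r.
Qed.

Context (N : nat) (d : 'I_N -> nat) (U : forall i : 'I_N, set 'cV[R]_(d i)).
Arguments U : clear implicits.

Lemma convex_prod_set : (forall i, @convex_set R 'cV[R]_(d i) (U i)) ->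
  @convex_set R 'cV[R]_(\sum_(i < N) d i) (prod_set U).
Proof.
move=> cU x y t /set_mem Ux /set_mem Uy; apply: mem_set => i.
rewrite (_ : submxcol _ i =
    t%:num *: submxcol x i + (1 - t%:num) *: submxcol y i); last first.
  by apply/colP => k; rewrite !mxE.
by apply: convex_comb.
Qed.

(** The squared distance is a sum over blocks, so stacking the blockwise projections yields a
    nearest point. *)
Lemma is_eproj_prod_set x : (forall i, U i !=set0) -> (forall i, compact (U i)) ->
  is_eproj (prod_set U) x (eproj (prod_set U) x).
Proof.
move=> U0 cU; apply: eproj_is_eproj.
have Pi i : is_eproj (U i) (submxcol x i) (eproj (U i) (submxcol x i)).
  by apply: eproj_is_eproj; exact: is_eproj_exists.
exists (\mxcol_i eproj (U i) (submxcol x i)); split.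
  by move=> i; rewrite mxcolK; case: (Pi i).
move=> y Uy; rewrite ler_enorm !edot_submxcol; apply: ler_sum => i _.
by rewrite !submxcolB mxcolK -ler_enorm; case: (Pi i) => _; apply.
Qed.

Lemma prod_set_bounded : (forall i, U i !=set0) -> (forall i, compact (U i)) ->
  exists c, forall x, prod_set U x -> enorm x <= c.
Proof.
move=> U0 cU.
have exp i : exists p : 'cV[R]_(d i), forall x, U i x -> enorm x <= enorm p.
  have [|p _ pmax] := @compact_EVT_max _ R (@enorm R (d i)) (U i) (U0 i) (cU i).
    by apply: continuous_subspaceT; exact: enorm_continuous.
  by exists p => x Ux; apply: pmax; exact: mem_set.
exists (enorm (\mxcol_i projT1 (cid (exp i)))) => x Ux.
rewrite ler_enorm !edot_submxcol; apply: ler_sum => i _.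
by rewrite mxcolK -ler_enorm; case: cid => p /= hp; apply: hp; exact: Ux.
Qed.

End Projection.

(** * Limit superior of a sequence under an affine recurrence *)

Section LimSup.
Variable R : realType.

Lemma limn_esup_le_cvg_bound (a v : nat -> R) (l : R) :
  (forall k, a k <= v k) -> v @ \oo --> l ->
  (limn_esup (fun k => (a k)%:E) <= l%:E)%E.
Proof.
move=> av vl; apply/lee_addgt0Pr => eps eps0.
have [n _ hn] : \forall k \near \oo, v k <= l + eps.
  by apply: (cvgr_le _ vl); rewrite ltrDl.
rewrite /limn_esup limf_esupE.
apply: (@le_trans _ _ (ereal_sup ((fun k => (a k)%:E) @` [set k | (n <= k)%N]))).
  by apply: ereal_inf_lbound; exists [set k | (n <= k)%N] => //; exists n.
apply: ge_ereal_sup => _ [k /= nk <-].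
by rewrite -EFinD lee_fin (le_trans (av k)) // hn.
Qed.

(** [c / (1 - q)] is the fixed point of [t -> q t + c], and the deviation from it shrinks by the
    factor [q] at each step. *)
Lemma affine_recurrence_le (a : nat -> R) (q c : R) :
  0 <= q -> q < 1 -> (forall k, a k.+1 <= q * a k + c) ->
  forall k, a k <= c / (1 - q) + q ^+ k * (a 0%N - c / (1 - q)).
Proof.
move=> q0 q1 ha; set b := c / (1 - q).
have bE : c = b - q * b.
  by rewrite -{1}(mul1r b) -mulrBl mulrC /b divfK // subr_eq0 eq_sym lt_eqF.
elim=> [|k IH]; first by rewrite expr0 mul1r addrC subrK.
apply: le_trans (ha k) _; rewrite exprS -mulrA {1}bE.
have := ler_wpM2l q0 IH; lra.
Qed.

Lemma cvg_affine_geometric (b z q : R) : 0 <= q -> q < 1 ->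
  (fun k => b + q ^+ k * z) @ \oo --> b.
Proof.
move=> q0 q1; rewrite -[X in _ --> X]addr0 -[X in _ --> _ + X](mul0r z).
apply: cvgD; first exact: cvg_cst.
by apply: cvgM; [apply: cvg_expr; rewrite ger0_norm|exact: cvg_cst].
Qed.

End LimSup.

(** * Error estimates along the coupled iteration *)

Section CoupledIteration.
Context (R : realType) (N : nat) (e : rel 'I_N) (he : simple_graph e).
Context (alpha : R) (d : 'I_N -> nat) (U : forall i : 'I_N, set 'cV[R]_(d i)).
Arguments U : clear implicits.
Context (hU0 : forall i, U i !=set0) (hUcompact : forall i, compact (U i))
  (hUconvex : forall i, @convex_set R 'cV[R]_(d i) (U i)).
Arguments hUcompact : clear implicits.
Arguments hUconvex : clear implicits.
Context (g : forall i : 'I_N, 'cV[R]_(\sum_(i < N) d i) -> 'cV[R]_(d i))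
  (Lip : 'I_N -> R).
Arguments g : clear implicits.
Context (hLip0 : forall i, 0 <= Lip i)
  (hLip : forall i x y, prod_set U x -> prod_set U y ->
       enorm (g i x - g i y) <= Lip i * enorm (x - y)).
Arguments hLip : clear implicits.
Context (T : nat) (eta : R) (heta : 0 < eta)
  (u : nat -> 'cV[R]_(\sum_(i < N) d i))
  (s : nat -> nat -> 'cV[R]_(N * \sum_(i < N) d i)).
Context (hu0 : prod_set U (u 0%N))
  (hiter : coupled_iteration (mixing e alpha) U g eta T u s).

Let sigma := spectral_norm (A_sys d (mixing e alpha)).
Let Lblk := \big[Num.max/0]_(i < N) Lip i.
Let Gmax := sup [set enorm (stack_map g x) | x in prod_set U].
Let err := tracking_error u s.

Lemma tracking_error_step k t : (t < T)%N ->
  err k t.+1 = A_sys d (mixing e alpha) *m err k t.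
Proof.
have [hs _ _] := hiter => tT; rewrite /err /tracking_error mul_A_sys hs //.
rewrite !mulmxBr (mixing_ones he); set w := _ *m s k t.
by rewrite !opprB -!addrA; congr (_ + _); rewrite [RHS]addrC addrA.
Qed.

Lemma tracking_error_inner k t : (t <= T)%N ->
  enorm (err k t) <= sigma ^+ t * enorm (err k 0%N).
Proof.
elim: t => [|t IH] tT; first by rewrite expr0 mul1r.
rewrite tracking_error_step // (le_trans (enorm_mulmx_le _ _)) //.
by rewrite exprS -mulrA ler_wpM2l ?spectral_norm_ge0 // IH // ltnW.
Qed.

Lemma iterate_in_prod_set k : prod_set U (u k).
Proof.
have [_ hu _] := hiter; case: k => [//|k] i; rewrite hu.
by case: (eproj_is_eproj (is_eproj_exists (submxcol (u k) i
    - eta *: g i (eproj (prod_set U) (stack_block (s k T) i)))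
  (hU0 i) (hUcompact i))).
Qed.

Lemma Lip_le_Lblk i : Lip i <= Lblk.
Proof. exact: le_bigmax. Qed.

Lemma Lblk_ge0 : 0 <= Lblk.
Proof. exact: bigmax_ge_id. Qed.

(** What needs proof is that the set under the supremum is bounded; this follows from the Lipschitz
    condition on a bounded product. *)
Lemma stack_map_le_Gmax x : prod_set U x -> enorm (stack_map g x) <= Gmax.
Proof.
move=> Ux; apply: ub_le_sup; last by exists x.
have [c hc] := prod_set_bounded hU0 hUcompact.
(* Block [i] is bounded by its value at [u 0] plus [Lip i] times the diameter bound [c + c].
   Collecting these numbers in a vector permits a blockwise comparison of norms. *)
exists (enorm (\mxcol_i (const_mx (enorm (g i (u 0%N)) + Lip i * (c + c)) : 'cV_1))).
move=> _ [y Uy <-]; rewrite ler_enorm !edot_submxcol; apply: ler_sum => i _.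
rewrite submxcol_stack_map mxcolK -sqr_enorm /edot big_ord1 mxE -expr2.
have c0 : 0 <= c by rewrite (le_trans (enorm_ge0 (u 0%N))) // hc.
rewrite ler_sqr ?nnegrE ?enorm_ge0 ?addr_ge0 ?enorm_ge0 ?mulr_ge0 ?addr_ge0 //.
rewrite -(subrK (g i (u 0%N)) (g i y)) addrC (le_trans (enormD _ _)) // lerD2l.
rewrite (le_trans (hLip i _ _ Uy hu0)) // ler_wpM2l // (le_trans (enormD _ _)) //.
by rewrite enormN lerD // hc.
Qed.

(** The step uses the direction [h], whose block [i] is [g i] at the estimate [sb i]. It is compared
    with [stack_map g (u k)]: block [i] of the difference is at most [Lblk] times block [i] of the
    tracking error, so summing squares over [i] costs no factor [sqrt N]. *)
Lemma iterate_drift k :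
  enorm (u k.+1 - u k) <= eta * (Gmax + Lblk * enorm (err k T)).
Proof.
have [_ hu _] := hiter.
pose sb i := eproj (prod_set U) (stack_block (s k T) i).
pose h := \mxcol_i g i (sb i).
have Usb i : is_eproj (prod_set U) (stack_block (s k T) i) (sb i).
  exact: is_eproj_prod_set.
have uk := iterate_in_prod_set k.
have projU i x : is_eproj (U i) x (eproj (U i) x).
  by apply: eproj_is_eproj; exact: is_eproj_exists.
have uh : enorm (u k.+1 - u k) <= enorm (eta *: h).
  rewrite ler_enorm !edot_submxcol; apply: ler_sum => i _.
  rewrite submxcolB submxcolZ mxcolK -ler_enorm hu.
  (* The old block is replaced by its own projection, so that nonexpansiveness compares two
     projections. *)
  rewrite -{2}(is_eproj_id (uk i) (projU i (submxcol (u k) i))).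
  rewrite (le_trans (is_eproj_nonexpansive (hUconvex i) (projU i _) (projU i _))) //.
  by rewrite addrAC subrr sub0r enormN.
apply: le_trans uh _; rewrite enormZ gtr0_norm // ler_pM2l //.
rewrite -(subrK (stack_map g (u k)) h) addrC (le_trans (enormD _ _)) // lerD //.
  exact: stack_map_le_Gmax.
have -> : Lblk * enorm (err k T) = enorm (Lblk *: err k T).
  by rewrite enormZ ger0_norm // Lblk_ge0.
(* The two vectors live in different dimensions, but both squared norms are sums over the same [N]
   indices: blocks of R^d on the left, copies of R^d on the right. *)
rewrite ler_enorm edot_submxcol edot_stack; apply: ler_sum => i _.
rewrite submxcolB submxcol_stack_map mxcolK stack_blockZ -ler_enorm.
rewrite (le_trans (hLip i _ _ (Usb i).1 uk)) // enormZ (ger0_norm Lblk_ge0).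
apply: ler_pM; rewrite ?enorm_ge0 ?Lip_le_Lblk //.
rewrite !stack_blockE.
have Uuk : is_eproj (prod_set U) (u k) (u k).
  have h0 := is_eproj_prod_set (u k) hU0 hUcompact.
  by rewrite -{2}(is_eproj_id uk h0).
exact: is_eproj_nonexpansive (convex_prod_set hUconvex) (Usb i) Uuk.
Qed.

Lemma tracking_error_outer k :
  enorm (err k.+1 0%N) <=
  sigma ^+ T * (1 + Num.sqrt N%:R * eta * Lblk) * enorm (err k 0%N)
  + Num.sqrt N%:R * eta * Gmax.
Proof.
have [_ _ hw] := hiter.
have -> : err k.+1 0%N = err k T - ones_tens N (u k.+1 - u k).
  by rewrite /err /tracking_error hw ones_tensB opprB addrA subrK.
apply: le_trans (enormD _ _) _; rewrite enormN enorm_ones.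
have n0 : 0 <= Num.sqrt N%:R :> R by exact: sqrtr_ge0.
have h1 := ler_wpM2l n0 (iterate_drift k).
have h2 : 0 <= 1 + Num.sqrt N%:R * eta * Lblk.
  by rewrite addr_ge0 // !mulr_ge0 ?Lblk_ge0 // ltW.
(* The error after [T] inner steps enters both directly and through the drift, with total
   coefficient [1 + sqrt N * eta * Lblk]; the inner contraction is applied to it once. *)
have := ler_wpM2l h2 (tracking_error_inner k (leqnn T)).
lra.
Qed.

End CoupledIteration.

Theorem theorem2 (R : realType) (N : nat) (hN : (2 <= N)%N)
    (e : rel 'I_N) (he : simple_graph e) (hconn : connected_graph e)
    (alpha : R) (halpha0 : 0 < alpha)
    (halpha1 : alpha < 1 / max_eigenvalue (laplacian R e))
    (d : 'I_N -> nat)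
    (U : forall i : 'I_N, set 'cV[R]_(d i))
    (hU0 : forall i, U i !=set0)
    (hUcompact : forall i, compact (U i))
    (hUconvex : forall i, @convex_set R 'cV[R]_(d i) (U i))
    (g : forall i : 'I_N, 'cV[R]_(\sum_(i < N) d i) -> 'cV[R]_(d i))
    (Lip : 'I_N -> R) (hLip0 : forall i, 0 <= Lip i)
    (hLip : forall i x y, prod_set U x -> prod_set U y ->
       enorm (g i x - g i y) <= Lip i * enorm (x - y))
    (T : nat) (hT : (1 <= T)%N) (eta : R) (heta : 0 < eta)
    (u : nat -> 'cV[R]_(\sum_(i < N) d i))
    (s : nat -> nat -> 'cV[R]_(N * \sum_(i < N) d i))
    (hu0 : prod_set U (u 0%N))
    (hiter : coupled_iteration (mixing e alpha) U g eta T u s) :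
  let sigma := spectral_norm (A_sys d (mixing e alpha)) in
  let Lblk := \big[Num.max/0]_(i < N) Lip i in
  let Gmax := sup [set enorm (stack_map g x) | x in prod_set U] in
  let qT := sigma ^+ T * (1 + Num.sqrt N%:R * eta * Lblk) in
  let err := tracking_error u s in
  (0 <= sigma < 1) /\
  (qT < 1 ->
   [/\ forall k, enorm (err k.+1 0%N)
                 <= qT * enorm (err k 0%N) + Num.sqrt N%:R * eta * Gmax,
       (limn_esup (fun k => (enorm (err k 0%N))%:E)
         <= (Num.sqrt N%:R * eta * Gmax / (1 - qT))%:E)%E
     & (limn_esup (fun k => (enorm (err k T))%:E)
         <= (Num.sqrt N%:R * eta * Gmax * sigma ^+ T / (1 - qT))%:E)%E]).
Proof.
move=> sigma Lblk Gmax qT err.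
have sigma0 : 0 <= sigma by exact: spectral_norm_ge0.
have sigma1 : sigma < 1.
  apply: spectral_norm_lt1; first exact: trmx_A_sys.
  by move=> x x0; exact: A_sys_form_lt.
split; first by rewrite sigma0.
move=> qT1.
have qT0 : 0 <= qT.
  by rewrite mulr_ge0 ?exprn_ge0 // addr_ge0 // !mulr_ge0 ?sqrtr_ge0 ?Lblk_ge0 ?ltW.
have step k : enorm (err k.+1 0%N) <=
    qT * enorm (err k 0%N) + Num.sqrt N%:R * eta * Gmax.
  exact: (tracking_error_outer he hU0 hUcompact hUconvex hLip0 hLip heta hu0 hiter).
have bound := affine_recurrence_le qT0 qT1 step.
set b := _ / (1 - qT) in bound *.
split => //.
  by apply: limn_esup_le_cvg_bound bound _; exact: cvg_affine_geometric.
(* The majorant of [|e^{k,0}|] is multiplied by the inner contraction factor, and therefore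
   converges to [sigma ^+ T * b]. *)
apply: (@limn_esup_le_cvg_bound _ _ (fun k => sigma ^+ T *
    (b + qT ^+ k * (enorm (err 0%N 0%N) - b)))) => [k|].
  apply: le_trans (tracking_error_inner he hiter k (leqnn T)) _.
  by rewrite ler_wpM2l ?exprn_ge0 ?bound.
rewrite mulrAC -/b mulrC; apply: cvgM; first exact: cvg_cst.
exact: cvg_affine_geometric.
Qed.
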